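(* Let $q$ be an odd prime power, let $\mathcal M_{\alpha,\beta}$ be a BM quasi-Hermitian variety of $\mathrm{PG}(3,q^2)$, and let $\varepsilon$ be a primitive element of $\mathrm{GF}(q^2)$. Then there exists $\alpha'\in\mathrm{GF}(q^2)\setminus\{0\}$ such that $\mathcal M_{\alpha,\beta}$ is equivalent to $\mathcal M_{\alpha',\varepsilon}$.
   Context: Let $q$ be an odd prime power and let $(J,X,Y,Z)$ be homogeneous coordinates of $\mathrm{PG}(3,q^2)$. Let $\Sigma_\infty$ be the plane $J=0$. For $\alpha\in\mathrm{GF}(q^2)\setminus\{0\}$ and $\beta\in\mathrm{GF}(q^2)\setminus\mathrm{GF}(q)$, let $\mathcal B_{\alpha,\beta}$ be the set of points of $\mathrm{PG}(3,q^2)$ satisfying \[Z^qJ^q-ZJ^{2q-1}+\alpha^q(X^{2q}+Y^{2q})-\alpha(X^2+Y^2)J^{2q-2}=(\beta^q-\beta)(X^{q+1}+Y^{q+1})J^{q-1},\] let $\mathcal F=\{(0,X,Y,Z): X^{q+1}+Y^{q+1}=0\}\subset\Sigma_\infty$, and define \[\mathcal M_{\alpha,\beta}:=(\mathcal B_{\alpha,\beta}\setminus\Sigma_\infty)\cup\mathcal F .\] The set $\mathcal M_{\alpha,\beta}$ is called a BM quasi-Hermitian variety when $4\alpha^{q+1}+(\beta^q-\beta)^2\neq 0$. Two BM quasi-Hermitian varieties $\mathcal M_{\alpha,\beta}$ and $\mathcal M_{\alpha',\beta'}$ are equivalent if there is a semilinear collineation $\psi\in\mathrm{P\Gamma L}(4,q^2)$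 with $\psi(\mathcal M_{\alpha,\beta})=\mathcal M_{\alpha',\beta'}$. (In particular, the conclusion includes that $\mathcal M_{\alpha',\varepsilon}$ is a BM quasi-Hermitian variety.) *)

(* Defs.v *)
From HB Require Import structures.
From mathcomp Require Import all_boot all_order all_algebra.
From mathcomp Require Import ring.

Set Implicit Arguments.
Unset Strict Implicit.
Unset Printing Implicit Defensive.

Import GRing.Theory.
Local Open Scope ring_scope.

Definition odd_prime_power (q : nat) : Prop :=
  odd q /\ exists p n : nat, [/\ prime p, (0 < n)%N & q = (p ^ n)%N].

(* Points of PG(3,F) are the one-dimensional subspaces of F^4. *)
Record point (F : finFieldType) := Point {
  point_space :> {vspace 'rV[F]_4};
  point_dim : \dim point_space == 1%N }.

HB.instance Definition _ (F : finFieldType) := [isSub for @point_space F].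
HB.instance Definition _ (F : finFieldType) := [Choice of point F by <:].

(* {vspace _} has no finType instance, so finiteness goes through the set of
   vectors of a point. *)
Definition point_vectors (F : finFieldType) (P : point F) : {set 'rV[F]_4} :=
  [set v | v \in point_space P].

Definition vectors_point (F : finFieldType) (A : {set 'rV[F]_4}) :
  option (point F) := insub <<enum A>>%VS.

Lemma point_vectorsK (F : finFieldType) :
  pcancel (@point_vectors F) (@vectors_point F).
Proof.
move=> P; rewrite /vectors_point.
suff -> : <<enum (point_vectors P)>>%VS = val P by exact: valK.
apply/eqP; rewrite eqEsubv; apply/andP; split.
  by apply/span_subvP => v; rewrite mem_enum inE.
by apply/subvP => v vP; apply: memv_span; rewrite mem_enum inE.
Qed.

HB.instance Definition _ (F : finFieldType) :=
  PCanIsCountable (@point_vectorsK F).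
HB.instance Definition _ (F : finFieldType) : isFinite (point F) :=
  PCanIsFinite (@point_vectorsK F).

Section Coordinates.
Variable F : finFieldType.
Implicit Type v : 'rV[F]_4.

Definition cJ v : F := v 0 0.
Definition cX v : F := v 0 1.
Definition cY v : F := v 0 2.
Definition cZ v : F := v 0 3.

(* Used only for conditions E that are invariant under nonzero scaling (see
   B_eqnZ below), so that the choice of the coordinate vector v of P is immaterial. *)
Definition locus (E : pred 'rV[F]_4) : {set point F} :=
  [set P | [exists v, [&& v != 0, v \in point_space P & E v]]].

End Coordinates.

Section BM.
Variables (F : finFieldType) (q : nat).
Implicit Types (a b : F) (v : 'rV[F]_4).

(* When #|F| = q ^ 2, this is the unique subfield of order q. *)
Definition GFq : {pred F} := [pred x | x ^+ q == x].

Definition B_eqn a b : pred 'rV[F]_4 := fun v =>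
  let J := cJ v in let X := cX v in let Y := cY v in let Z := cZ v in
  Z ^+ q * J ^+ q - Z * J ^+ (2 * q - 1)
    + a ^+ q * (X ^+ (2 * q) + Y ^+ (2 * q))
    - a * (X ^+ 2 + Y ^+ 2) * J ^+ (2 * q - 2)
  == (b ^+ q - b) * (X ^+ q.+1 + Y ^+ q.+1) * J ^+ (q - 1).

Lemma B_eqnZ a b c v : (0 < q)%N -> c != 0 -> B_eqn a b (c *: v) = B_eqn a b v.
Proof.
move=> q0 c0; rewrite /B_eqn /cJ /cX /cY /cZ !mxE.
move: (v 0 0) (v 0 1) (v 0 2) (v 0 3) => J X Y Z.
have e1 : c * c ^+ (2 * q - 1) = c ^+ (2 * q).
  by rewrite -exprS subn1 prednK // muln_gt0.
have e2 : c ^+ 2 * c ^+ (2 * q - 2) = c ^+ (2 * q).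
  by rewrite -exprD subnKC // leq_pmulr.
have e3 : c ^+ q.+1 * c ^+ (q - 1) = c ^+ (2 * q).
  by rewrite -exprD addSnnS subn1 prednK // mul2n addnn.
have e4 : c ^+ q * c ^+ q = c ^+ (2 * q) by rewrite -exprD mul2n addnn.
rewrite -subr_eq0 -[in RHS]subr_eq0 !exprMn.
set l := (X in (X == 0) = _); set r := (X in _ = (X == 0)).
suff -> : l = c ^+ (2 * q) * r by rewrite mulf_eq0 expf_eq0 (negPf c0) andbF.
rewrite {}/l {}/r; move: e1 e2 e3 e4.
move: (c ^+ q.+1) (c ^+ (q - 1)) (c ^+ q) (c ^+ (2 * q - 1)) (c ^+ (2 * q - 2)).
move: (c ^+ (2 * q)) (X ^+ q.+1) (Y ^+ q.+1) (J ^+ (q - 1)) (J ^+ (2 * q - 1)).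
move: (J ^+ (2 * q - 2)) (J ^+ q) (Z ^+ q) (X ^+ (2 * q)) (Y ^+ (2 * q)).
move: (a ^+ q) (b ^+ q - b) => a' b' J1 J2 Z1 X1 Y1 K X2 Y2 J3 J4 s t r u w.
move=> e1 e2 e3 e4.
transitivity (r * r * (Z1 * J2) - c * u * (Z * J4) + K * (a' * (X1 + Y1))
   - c ^+ 2 * w * (a * (X ^+ 2 + Y ^+ 2) * J1)
   - s * t * (b' * (X2 + Y2) * J3)); first by ring.
by rewrite e1 e2 e3 e4; ring.
Qed.

Definition B_set a b : {set point F} := locus (B_eqn a b).

Definition Sigma_inf : {set point F} := locus (fun v => cJ v == 0).

Definition F_set : {set point F} :=
  locus (fun v => (cJ v == 0) && (cX v ^+ q.+1 + cY v ^+ q.+1 == 0)).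

Definition M_set a b : {set point F} := (B_set a b :\: Sigma_inf) :|: F_set.

(* M_set a b is a BM quasi-Hermitian variety. *)
Definition is_BM a b : Prop :=
  [/\ a != 0, b \notin GFq & 4 * a ^+ q.+1 + (b ^+ q - b) ^+ 2 != 0].

End BM.

Definition semilinear (F : finFieldType) (f : 'rV[F]_4 -> 'rV[F]_4) : Prop :=
  exists sigma : {rmorphism F -> F},
    [/\ bijective sigma, {morph f : u v / u + v}
      & forall a v, f (a *: v) = sigma a *: f v].

(* The elements of PGammaL(4,F), as permutations of the points. *)
Definition semilinear_collineation (F : finFieldType)
    (psi : point F -> point F) : Prop :=
  exists f : 'rV[F]_4 -> 'rV[F]_4,
    [/\ bijective f, semilinear f
      & forall P, point_vectors (psi P) = f @: point_vectors P].

Definition equivalent (F : finFieldType) (S T : {set point F}) : Prop :=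
  exists psi : point F -> point F, semilinear_collineation psi /\ psi @: S = T.

(* Main.v *)
Require Import Defs.
From mathcomp Require Import all_boot all_order all_algebra.
From mathcomp Require Import finfield ring zify.

(* On J = 1 only the difference b ^ q - b of beta enters the equation. For every
   b outside GF(q) this difference is a nonzero element whose q-th power is its
   opposite, so the ratio k of the differences of eps and beta lies in GF(q).
   Hence multiplying the equation by k amounts to replacing Z by k Z, alpha by
   k alpha and beta by eps, and diag(1, 1, 1, k) maps the first variety onto the
   second. *)

Import GRing.Theory.
Local Open Scope ring_scope.

(** In finite dimension an injective [g] is bijective; being linear, it induces a collineation whose
    field automorphism is the identity. Quantifying over pairs [P], [Q] keeps that collineation out
    of later proofs. *)
Lemma lker0_equivalent (F : finFieldType) (g : 'End('rV[F]_4))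
    (S T : {set point F}) :
  lker g == 0%VS ->
  (forall P Q : point F, point_space Q = (g @: point_space P)%VS ->
     (Q \in T) = (P \in S)) ->
  equivalent S T.
Proof.
move=> kerg gST.
have gdim (h : 'End('rV[F]_4)) (P : point F) :
    lker h == 0%VS -> \dim (h @: point_space P) == 1%N.
  move=> /eqP kerh; rewrite limg_dim_eq ?point_dim //.
  by rewrite kerh capv0.
pose psi P := Point (gdim g P kerg).
exists psi; split.
  exists g; split.
  - exact: Bijective (lker0_lfunK kerg) (lker0_lfunVK kerg).
  - exists idfun; split; [by exists idfun | exact: linearD | exact: linearZZ].
  - move=> P; apply/setP => v; rewrite inE /=.
    apply/idP/imsetP => [/memv_imgP[u uP ->]|[u]]; first by exists u; rewrite ?inE.
    by rewrite inE => uP ->; apply: memv_img.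
apply/setP => Q; apply/imsetP/idP => [[P PS ->]|QT]; first by rewrite (gST P).
(* Surjectivity of [psi] on [T]: the preimage of [Q] is its image under the inverse of [g]. *)
have kerV : lker g^-1%VF == 0%VS.
  by apply/lker0P; apply: can_inj (lker0_lfunVK kerg).
have Q_psi : Q = psi (Point (gdim _ Q kerV)).
  by apply: val_inj; rewrite /= -limg_comp lker0_compfV // lim1g.
exists (Point (gdim _ Q kerV)) => //.
by rewrite -(gST _ Q) // {1}Q_psi.
Qed.

Lemma locus_lker0 (F : finFieldType) (g : 'End('rV[F]_4))
    (E E' : pred 'rV[F]_4) (P Q : point F) :
  lker g == 0%VS -> (forall v, E' (g v) = E v) ->
  point_space Q = (g @: point_space P)%VS ->
  (Q \in locus E') = (P \in locus E).
Proof.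
move=> kerg EE' QP; rewrite !inE.
have g0 v : (g v == 0) = (v == 0).
  by rewrite -{1}(linear0 g) (inj_eq (lker0P kerg)).
apply/existsP/existsP => -[v /and3P[v0 vP Ev]].
  move: vP v0 Ev; rewrite QP => /memv_imgP[u uP ->].
  by rewrite g0 EE' => u0 Eu; exists u; rewrite u0 uP.
by exists (g v); rewrite g0 v0 EE' QP memv_img.
Qed.

(** Coordinate vectors are rows, so the matrix diag(1, 1, 1, k) acts from the right. *)
Definition scaleZ (F : finFieldType) (k : F) : 'End('rV[F]_4) :=
  linfun (mulmxr (diag_mx (\row_j if j == 3 :> 'I_4 then k else 1))).

Lemma scaleZE (F : finFieldType) (k : F) v j :
  scaleZ F k v 0 j = v 0 j * (if j == 3 :> 'I_4 then k else 1).
Proof. by rewrite lfunE /= mul_mx_diag !mxE. Qed.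

Lemma lker_scaleZ (F : finFieldType) (k : F) :
  k != 0 -> lker (scaleZ F k) == 0%VS.
Proof.
move=> k0; apply/lker0P => u v uv; apply/rowP => j.
have /rowP/(_ j) := uv; rewrite !scaleZE.
by apply: mulIf; case: ifP; rewrite ?oner_neq0.
Qed.

Lemma coord_scaleZ (F : finFieldType) (k : F) v :
  [/\ cJ (scaleZ F k v) = cJ v, cX (scaleZ F k v) = cX v,
      cY (scaleZ F k v) = cY v & cZ (scaleZ F k v) = k * cZ v].
Proof. by rewrite /cJ /cX /cY /cZ !scaleZE /= !mulr1 mulrC. Qed.

(** Each term is linear in exactly one of [Z], [a], their [q]-th powers and [b ^+ q - b]. As
    [k ^+ q = k], both sides gain one factor [k], which cancels. *)
Lemma B_eqn_scaleZ (F : finFieldType) (q : nat) (k a b b' : F) v :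
  k != 0 -> k ^+ q = k -> b' ^+ q - b' = k * (b ^+ q - b) ->
  B_eqn q (k * a) b' (scaleZ F k v) = B_eqn q a b v.
Proof.
move=> k0 kq bb'; rewrite /B_eqn; have [-> -> -> ->] := coord_scaleZ F k v.
rewrite bb' !exprMn kq -!mulrA -!mulrBr -mulrDr -mulrBr.
by rewrite (inj_eq (mulfI k0)).
Qed.

(** The parts at infinity are described by [J], [X], [Y] alone, which [scaleZ] fixes, so only the
    affine equation changes. *)
Lemma M_set_scaleZ (F : finFieldType) (q : nat) (k a b b' : F) :
  k != 0 -> k ^+ q = k -> b' ^+ q - b' = k * (b ^+ q - b) ->
  equivalent (M_set q a b) (M_set q (k * a) b').
Proof.
move=> k0 kq bb'; have kerk := lker_scaleZ F k k0.
apply: (lker0_equivalent F _ _ _ kerk) => P Q QP.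
rewrite /M_set !in_setU !in_setD.
congr (~~ _ && _ || _); apply: locus_lker0 kerk _ QP => v.
- by have [-> _ _ _] := coord_scaleZ F k v.
- exact: B_eqn_scaleZ.
- by have [-> -> -> _] := coord_scaleZ F k v.
Qed.

(** Since [k ^+ q.+1 = k ^+ 2], both terms of the discriminant gain the factor [k ^+ 2]. *)
Lemma is_BM_scale (F : finFieldType) (q : nat) (k a b b' : F) :
  k != 0 -> k ^+ q = k -> b' ^+ q - b' = k * (b ^+ q - b) ->
  is_BM q a b -> is_BM q (k * a) b'.
Proof.
move=> k0 kq bb' [a0 bq nz]; split; first by rewrite mulf_neq0.
  by rewrite inE -subr_eq0 bb' mulf_neq0 // subr_eq0.
suff -> : 4 * (k * a) ^+ q.+1 + (b' ^+ q - b') ^+ 2 =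
          k ^+ 2 * (4 * a ^+ q.+1 + (b ^+ q - b) ^+ 2).
  by rewrite mulf_neq0 ?expf_neq0.
by rewrite bb' (exprMn q.+1) (exprS k q) kq; ring.
Qed.

(** The cardinality forces characteristic [p], so this power map is an iterate of Frobenius. *)
Lemma exprB_primepow (F : finFieldType) (p n m : nat) (x y : F) :
  prime p -> #|F| = (p ^ m)%N ->
  (x - y) ^+ (p ^ n) = x ^+ (p ^ n) - y ^+ (p ^ n).
Proof.
move=> p_pr cF; have pF := card_finPcharP cF p_pr.
have ppn : [pchar F].-nat (p ^ n)%N.
  by rewrite (eq_pnat _ (pcharf_eq pF)) pnatX pnat_id.
by rewrite exprDn_pchar // exprNn_pchar.
Qed.

(** Every element satisfies [b ^+ (q ^ 2) = b], so the [q]-th power swaps the two terms. *)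
Lemma subX_anti_fixed (F : finFieldType) (q : nat) (b : F) :
  odd_prime_power q -> #|F| = (q ^ 2)%N ->
  (b ^+ q - b) ^+ q = - (b ^+ q - b).
Proof.
move=> [_ [p [n [p_pr _ ->]]]] cF.
rewrite (exprB_primepow _ p n (n * 2)) // ?cF ?expnM //.
by rewrite -exprM -[(_ * _)%N]/((p ^ n) ^ 2)%N -cF expf_card opprB.
Qed.

Theorem lemma5p5 (q : nat) (hq : odd_prime_power q)
  (F : finFieldType) (hF : #|F| = (q ^ 2)%N)
  (alpha beta : F) (hM : is_BM q alpha beta)
  (eps : F) (heps : (q ^ 2 - 1)%N.-primitive_root eps) :
  exists alpha' : F, [/\ alpha' != 0, is_BM q alpha' eps
    & equivalent (M_set q alpha beta) (M_set q alpha' eps)].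
Proof.
have [_ beta_q _] := hM.
have q2 : (2 < q)%N.
  case: hq => oddq [p [n [/prime_gt1 p1 n0 qE]]].
  have : (1 < q)%N by rewrite qE -(exp1n n) ltn_exp2r.
  by case: (q) oddq => [|[|[]]].
pose d := beta ^+ q - beta; pose e := eps ^+ q - eps.
have d0 : d != 0 by rewrite subr_eq0.
have e0 : e != 0.
  (* If [eps ^+ q = eps], then [q] and 1 would agree modulo the order [q ^ 2 - 1] of [eps]; both lie
     below it and they differ. *)
  have [gt1 gtq] : (1 < q ^ 2 - 1 /\ q < q ^ 2 - 1)%N by nia.
  rewrite subr_eq0 -[eqbRHS]expr1 (eq_prim_root_expr heps) !modn_small //.
  by rewrite neq_ltn (ltn_trans _ q2) ?orbT.
have kq : (e / d) ^+ q = e / d.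
  by rewrite expr_div_n !(subX_anti_fixed F q _ hq hF) invrN mulrNN.
have k0 : e / d != 0 by rewrite mulf_neq0 ?invr_eq0.
have ed : e = e / d * d by rewrite divfK.
have BM' := is_BM_scale F q _ _ _ _ k0 kq ed hM.
exists (e / d * alpha); split => //; first by case: BM'.
exact: M_set_scaleZ.
Qed.
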